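(* Let $N\ge 2$, $\sigma>0$, $f_D>0$, and let $\mu_2,\dots,\mu_N\in[0,1)$. Consider the $N$-port fluid antenna system (FAS) channel model described in the context, with selected envelope $|h_{\mathrm{FAS}}|=\max\{|h_1|,\dots,|h_N|\}$. Then for every threshold $x_{\rm th}>0$ the level crossing rate of $|h_{\mathrm{FAS}}|$ is \begin{align*} L(x_{\rm th})&=\frac{\sqrt{2\pi}\,x_{\rm th}f_D}{\sigma} \Biggl\{ e^{-\frac{x_{\rm th}^2}{\sigma ^2}} \prod _{k=2}^N \left[ 1-Q_1 \left( \sqrt{\tfrac{2\mu_k^2}{\sigma ^{2}(1-\mu _{k}^{2})}}\, x_{\rm th} , \sqrt{\tfrac{2}{\sigma ^{2}(1-\mu _{k}^{2})}}\, x_{\rm th} \right) \right] \\ &\quad + \sum_{i=2}^N \frac {1}{1-\mu _i^{2}}e^{-\frac {x_{\rm th}^{2}}{\sigma ^{2}(1-\mu _i^{2})}} \int_0^{x_{\rm th}} \frac{2x_1}{\sigma^2}e^{-\frac{x_1^2}{\sigma ^{2}(1-\mu _i^{2})}} I_{0}\!\left ({\frac {2\mu _ix_{\rm th}x_1}{\sigma ^{2}(1-\mu _i^{2})}}\right) \\ &\qquad\qquad \times \prod _{\substack{k=2 \\ k \neq i}}^N \left[ 1-Q_1 \left( \sqrt{\tfrac{2\mu_k^2}{\sigma ^{2}(1-\mu _{k}^{2})}}\, x_1 , \sqrt{\tfrac{2}{\sigma ^{2}(1-\mu _{k}^{2})}}\, x_{\rm th} \right) \right]dx_1 \Biggr\},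 \end{align*} where $Q_1(a,b)$ is the first-order Marcum $Q$-function and $I_0$ is the zero-order modified Bessel function of the first kind.
   Context: FAS channel model: a receiver has $N$ ports; the channels are $h_1=\sigma x_0+j\sigma y_0$ and $h_k=\sigma(\sqrt{1-\mu_k^2}\,x_k+\mu_k x_0)+j\sigma(\sqrt{1-\mu_k^2}\,y_k+\mu_k y_0)$ for $k=2,\dots,N$, where $x_0,\dots,x_N,y_0,\dots,y_N$ are independent real Gaussian random variables with mean $0$ and variance $1/2$; thus $\mathbb{E}|h_k|^2=\sigma^2$. (In the paper's setting $\mu_k=J_0\!\left(\frac{2\pi(k-1)}{N-1}W\right)$ for a normalized aperture $W$, $J_0$ the Bessel function of the first kind of order zero.) With the convention $\mu_1:=0$, the joint density of the envelopes is $p_{|h_1|,\dots,|h_N|}(x_1,\dots,x_N)=\prod_{k=1}^N \frac{2x_k}{\sigma^2(1-\mu_k^2)}e^{-\frac{x_k^2+\mu_k^2x_1^2}{\sigma^2(1-\mu_k^2)}}I_0\!\left(\frac{2\mu_kx_1x_k}{\sigma^2(1-\mu_k^2)}\right)$ for $x_1,\dots,x_N\ge 0$. The FAS selects $|h_{\rm FAS}|=\max_k|h_k|$. Level crossing rate (LCR): the time derivative $|\dot h_i|$ of the envelope at each port $i$ (at an arbitrary instant) is modeled as a zero-mean Gaussian with density $p_{|\dot h_i|}$ and variance $\pi^2\sigma^2f_D^2$, where $f_D$ is the maximum Doppler frequency. The joint density of the derivative and value of the selected envelope is taken to be $p_{|\dot h|,|h|}(\dot x,x)=\sum_{i=1}^N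 p_{|\dot h_i|}(\dot x)\int_{[0,x]^{N-1}} p_{|h_1|,\dots,|h_N|}(x_1,\dots,x_{i-1},x,x_{i+1},\dots,x_N)\prod_{k\ne i}dx_k$, and the LCR at threshold $x_{\rm th}$ is $L(x_{\rm th})=\int_0^\infty \dot x\, p_{|\dot h|,|h|}(\dot x,x_{\rm th})\,d\dot x$. *)

(* Defs.v *)
From HB Require Import structures.
From mathcomp Require Import all_boot all_order all_algebra.
From mathcomp Require Import all_classical all_reals all_analysis.
Set Implicit Arguments. Unset Strict Implicit. Unset Printing Implicit Defensive.
Import Order.TTheory GRing.Theory Num.Theory.
Import numFieldNormedType.Exports.
Local Open Scope classical_set_scope.
Local Open Scope ring_scope.

Section FAS.
Variable R : realType.
Local Notation mu := (@lebesgue_measure R).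

Definition besselI0 (z : R) : R :=
  pi^-1 * Rintegral mu `[0, pi] (fun t => expR (z * cos t)).

Definition marcumQ1 (a b : R) : R :=
  Rintegral mu `[b, +oo[
    (fun x => x * expR (- (x ^+ 2 + a ^+ 2) / 2) * besselI0 (a * x)).

(* correlation coefficients with the convention mu_1 := 0 *)
Definition muc (m : nat -> R) (k : nat) : R := if k == 1%N then 0 else m k.

(* joint density of (|h_1|,...,|h_N|); ports indexed 1..N, x : nat -> R *)
Definition fas_joint_pdf (N : nat) (sigma : R) (m : nat -> R) (x : nat -> R) : R :=
  \prod_(1 <= k < N.+1)
    (let c := sigma ^+ 2 * (1 - muc m k ^+ 2) in
     (2 * x k / c) * expR (- (x k ^+ 2 + muc m k ^+ 2 * x 1%N ^+ 2) / c)
       * besselI0 (2 * muc m k * x 1%N * x k / c)).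

Definition upd (x : nat -> R) (k : nat) (t : R) : nat -> R :=
  fun j => if j == k then t else x j.

Fixpoint iter_int (s : seq nat) (b : R) (F : (nat -> R) -> R) (x : nat -> R) : R :=
  match s with
  | [::] => F x
  | k :: s' => Rintegral mu `[0, b] (fun t => iter_int s' b F (upd x k t))
  end.

Definition deriv_pdf (sigma fD : R) (xd : R) : R :=
  let v := pi ^+ 2 * sigma ^+ 2 * fD ^+ 2 in
  expR (- xd ^+ 2 / (2 * v)) / Num.sqrt (2 * pi * v).

(* joint density of derivative and value of the selected envelope:
   sum_i p_{|hdot_i|}(xd) * int_{[0,x]^{N-1}} p(x_1,..,x_{i-1},x,x_{i+1},..,x_N) prod_{k<>i} dx_k *)
Definition fas_joint_deriv_pdf (N : nat) (sigma fD : R) (m : nat -> R) (xd x : R) : R :=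
  \sum_(1 <= i < N.+1)
    deriv_pdf sigma fD xd *
      iter_int [seq k <- iota 1 N | k != i] x (fas_joint_pdf N sigma m) (fun _ => x).

Definition fas_lcr (N : nat) (sigma fD : R) (m : nat -> R) (xth : R) : R :=
  Rintegral mu `[0, +oo[ (fun xd => xd * fas_joint_deriv_pdf N sigma fD m xd xth).

End FAS.

(* Main.v *)
Require Import Defs.
From HB Require Import structures.
From mathcomp Require Import all_boot all_order all_algebra.
From mathcomp Require Import all_classical all_reals all_analysis.
From mathcomp Require Import ring lra zify measurable_realfun.
Set Implicit Arguments. Unset Strict Implicit. Unset Printing Implicit Defensive.
Import Order.TTheory GRing.Theory Num.Theory.
Import numFieldNormedType.Exports.
Local Open Scope classical_set_scope.
Local Open Scope ring_scope.

(** Given x_1, the joint density is a product of functions of one variable each,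
    so the iterated integrals factor; after the scaling x_k -> sqrt(2/c_k) x_k,
    c_k = sigma^2 (1 - mu_k^2), every factor becomes the integral over [0, b] of
    the Rice density x e^{-(x^2+a^2)/2} I_0(ax).  It equals 1 - Q_1(a, b) because
    the Rice density has total mass 1.  For the latter, symmetrizing e^{z cos t}
    into cosh(z cos t) and using Wallis' integrals gives
    I_0(z) = sum_n z^{2n} / (4^n n!^2) with nonnegative terms, and integrating
    term by term against the odd Gaussian moments resums to e^{a^2/2}.  The
    integral over the derivative variable is the first half-line Gaussian
    moment. *)

(** * Fundamental theorem of calculus, Wallis integrals, Gaussian primitives *)

Section calculus.
Variable R : realType.
Local Notation mu := (@lebesgue_measure R).
Implicit Types (f F : R -> R).

Lemma is_derive_continuous F f : (forall x : R, is_derive x 1 F (f x)) -> continuous F.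
Proof.
by move=> dF x; apply/differentiable_continuous/derivable1_diffP; case: (dF x).
Qed.

Lemma is_derive_LRcontinuous F f a b :
  (forall x : R, is_derive x 1 F (f x)) -> derivable_oo_LRcontinuous F a b.
Proof.
move=> dF; have cF := is_derive_continuous dF; split.
- by move=> x _; case: (dF x).
- exact/cvg_at_right_filter/cF.
- exact/cvg_at_left_filter/cF.
Qed.

Lemma is_derive_FTC2 f F a b : a < b -> continuous f ->
  (forall x : R, is_derive x 1 F (f x)) ->
  (\int[mu]_(x in `[a, b]) (f x)%:E = (F b - F a)%:E)%E.
Proof.
move=> ab cf dF; rewrite (@continuous_FTC2 R f F)//.
- exact: continuous_subspaceT.
- exact: is_derive_LRcontinuous dF.
- by move=> x _; rewrite derive1E; apply: derive_val.
Qed.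

Lemma is_derive_FTC2y f F a (l : R) : (forall x, a <= x -> 0 <= f x) ->
  continuous f -> (forall x : R, is_derive x 1 F (f x)) ->
  F x @[x --> +oo] --> l ->
  (\int[mu]_(x in `[a, +oo[) (f x)%:E = (l - F a)%:E)%E.
Proof.
move=> f0 cf dF Fl; rewrite (@ge0_continuous_FTC2y R f F a l)//.
- exact: continuous_subspaceT.
- exact/cvg_at_right_filter/(is_derive_continuous dF).
- by move=> x _; rewrite derive1E; apply: derive_val.
Qed.

Lemma continuous_integrable_itv f a b :
  continuous f -> mu.-integrable `[a, b] (EFin \o f).
Proof.
move=> cf; apply: continuous_compact_integrable; first exact: segment_compact.
exact: continuous_subspaceT.
Qed.

(** Integrated over [[0, pi]], where [sin] vanishes at both ends, this yields the Wallis recursion;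
    [sin ^ 2 = 1 - cos ^ 2] keeps only even powers of [cos]. *)
Lemma is_derive_sin_cosX n (t : R) : is_derive t 1
  (fun t => sin t * cos t ^+ n.*2.+1)
  (n.*2.+2%:R * cos t ^+ n.*2.+2 - n.*2.+1%:R * cos t ^+ n.*2).
Proof.
have -> : (fun t : R => sin t * cos t ^+ n.*2.+1) = sin * cos ^+ n.*2.+1.
  by apply/funext => y; rewrite fctE exprfctE.
apply: is_derive_eq.
rewrite exprfctE.
rewrite /GRing.scale/=.
rewrite !exprS.
have -> : sin t * (n.*2.+1%:R * cos t ^+ n.*2 * - sin t) =
  - (sin t ^+ 2) * (n.*2.+1%:R * cos t ^+ n.*2) by ring.
rewrite sin2cos2 -(natr1 n.*2.+1).
by ring.
Qed.

(** The central binomial coefficient over [4 ^ n], which is the mean of [cos ^ (2n)] over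
    [[0, pi]]. *)
Definition wallis n : R := n.*2`!%:R / (4 ^+ n * n`!%:R ^+ 2).

Lemma wallisS n : n.*2.+2%:R * wallis n.+1 = n.*2.+1%:R * wallis n.
Proof.
rewrite /wallis doubleS !factS exprS !natrM -muln2.
have h : forall k, k`!%:R != 0 :> R by move=> k; rewrite pnatr_eq0 -lt0n fact_gt0.
have h4 : 4 ^+ n != 0 :> R by rewrite expf_neq0.
have -> : (n * 2).+2%:R = 2 * n.+1%:R :> R.
  by rewrite -natrM; congr (_%:R); lia.
have h1 : n.+1%:R != 0 :> R by rewrite pnatr_eq0.
have := h n; have := h1; move: h4 (n.+1%:R) (n`!%:R) => h4 a b a0 b0.
by field; rewrite a0 b0 h4.
Qed.

Lemma continuous_cosX n : continuous (fun t : R => cos t ^+ n).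
Proof.
move=> t; apply: (@continuous_comp _ _ _ cos (fun z => z ^+ n)).
  exact: continuous_cos.
exact: exprn_continuous.
Qed.

Lemma Rintegral_cosX n :
  \int[mu]_(t in `[0, pi]) cos t ^+ n.*2 = pi * wallis n.
Proof.
elim: n => [|n IH].
  under eq_Rintegral do rewrite expr0.
  rewrite Rintegral_cst//= lebesgue_measure_itv/= lte_fin pi_gt0/= mul1r.
  by rewrite oppr0 addr0 /wallis fact0 !expr1n mulr1 divr1 mulr1.
have cc (a : R) k : continuous (fun t : R => a * cos t ^+ k).
  by move=> t; apply: cvgM; [exact: cvg_cst|exact: continuous_cosX].
have cf : continuous (fun t : R =>
    n.*2.+2%:R * cos t ^+ n.*2.+2 - n.*2.+1%:R * cos t ^+ n.*2).
  by move=> t; apply: cvgB; exact: cc.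
have := is_derive_FTC2 (pi_gt0 R) cf (is_derive_sin_cosX n).
move/(congr1 fine); rewrite /= sin0 sinpi !mul0r subr0.
rewrite -[fine _]/(Rintegral _ _ _) RintegralB//; last 2 first.
- exact: continuous_integrable_itv.
- exact: continuous_integrable_itv.
rewrite !RintegralZl//; last 2 first.
- exact/continuous_integrable_itv/continuous_cosX.
- exact/continuous_integrable_itv/continuous_cosX.
move/eqP; rewrite subr_eq0 IH mulrCA -wallisS mulrCA => /eqP.
by apply: mulfI; rewrite pnatr_eq0.
Qed.

(* The antiderivative of [x ^+ n.*2.+1 * expR (- p * x ^+ 2)] produced by
   repeated integration by parts. *)
Fixpoint gmoment_prim (p : R) n (x : R) : R :=
  if n is n'.+1 then
    - x ^+ n.*2 * expR (- p * x ^+ 2) / (2 * p) + n%:R / p * gmoment_prim p n' x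
  else - expR (- p * x ^+ 2) / (2 * p).

Lemma is_derive_gauss p (x : R) :
  is_derive x 1 (fun x => expR (- p * x ^+ 2)) (- (2 * p * x) * expR (- p * x ^+ 2)).
Proof.
have h : is_derive x 1 (- p \*: (@idfun R ^+ 2)) (- (2 * p * x)).
  by apply: is_derive_eq; rewrite /GRing.scale/=; ring.
have := @is_derive1_comp R expR _ x _ _ (is_derive_expR _) h.
rewrite /GRing.scale/= => h'.
rewrite (_ : (fun x => _) = expR \o (- p \*: (@idfun R ^+ 2))); last first.
  by apply/funext => y /=; rewrite exprfctE.
apply: is_derive_eq.
by rewrite /= exprfctE mulrC.
Qed.

End calculus.

(** * Odd Gaussian moments on the half-line *)

Section moments.
Variable R : realType.
Local Notation mu := (@lebesgue_measure R).

Lemma continuous_XMgauss p n : continuous (fun x : R => x ^+ n * expR (- p * x ^+ 2)).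
Proof.
move=> x; apply: cvgM; first exact: exprn_continuous.
exact: (is_derive_continuous (is_derive_gauss p)).
Qed.

(** Differentiating the leading term gives the wanted integrand minus [(n+1)/p] times the previous
    one, and the recursive term cancels the latter. *)
Lemma is_derive_gmoment_prim (p : R) n (x : R) : p != 0 ->
  is_derive x 1 (gmoment_prim p n) (x ^+ n.*2.+1 * expR (- p * x ^+ 2)).
Proof.
move=> p0; elim: n => [|n IH] /=.
  rewrite (_ : (fun x => _) = (- (2 * p)^-1) \*: (fun x => expR (- p * x ^+ 2))).
    have h := is_derive_gauss p x.
    by apply: is_derive_eq; rewrite /GRing.scale/=; field.
  by apply/funext => y; rewrite -[RHS]/(- (2 * p)^-1 * expR (- p * y ^+ 2)); ring.
rewrite (_ : (fun x => _) =
  (- (2 * p)^-1) \*: ((@idfun R ^+ n.*2.+2) * (fun x => expR (- p * x ^+ 2))) +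
  (n.+1%:R / p) \*: gmoment_prim p n); last first.
  apply/funext => y; rewrite exprfctE.
  rewrite -[RHS]/(- (2 * p)^-1 * (y ^+ n.*2.+2 * expR (- p * y ^+ 2)) +
    n.+1%:R / p * gmoment_prim p n y).
  by ring.
have h := is_derive_gauss p x.
apply: is_derive_eq; rewrite exprfctE /GRing.scale/=.
rewrite doubleS (natrD _ 2 n.*2 : n.*2.+2%:R = _) -mul2n natrM -[n.+1%:R]natr1.
rewrite !(exprS _ (2 * n).+2) !(exprS _ (2 * n).+1) !(exprS _ (2 * n)).
move: (expR _) (x ^+ (2 * n)) n%:R => e y k.
by field.
Qed.

Lemma gmoment_prim0 p n : p != 0 ->
  gmoment_prim p n 0 = - (n`!%:R / (2 * p ^+ n.+1)) :> R.
Proof.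
move=> p0; elim: n => [|n IH] /=.
  by rewrite expr0n/= mulr0 expR0 fact0 expr1 mulNr.
rewrite IH !expr0n/= oppr0 !mul0r add0r factS natrM [p ^+ n.+2]exprS.
have : p ^+ n.+1 != 0 by rewrite expf_neq0.
move: (p ^+ n.+1) (n`!%:R) (n.+1%:R) => a b c a0.
by field; rewrite p0 a0.
Qed.

(** Half of the exponent absorbs the power: [y ^ n <= n! * e ^ y] for [y = p x^2 / 2]. The other
    half still forces decay at infinity. *)
Lemma XMgauss_le p n (x : R) : 0 < p ->
  x ^+ n.*2 * expR (- p * x ^+ 2) <= n`!%:R * (2 / p) ^+ n * expR (- (p / 2 * x ^+ 2)).
Proof.
move=> p0.
have y0 : 0 <= p / 2 * x ^+ 2 by rewrite mulr_ge0 ?sqr_ge0// divr_ge0// ltW.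
have -> : - p * x ^+ 2 = - (p / 2 * x ^+ 2) + - (p / 2 * x ^+ 2) by field.
have -> : x ^+ n.*2 = (2 / p) ^+ n * (p / 2 * x ^+ 2) ^+ n.
  rewrite -exprMn mulrA; have -> : 2 / p * (p / 2) = 1 by field; rewrite gt_eqF.
  by rewrite mul1r -exprM mul2n.
move: (p / 2 * x ^+ 2) y0 => y y0.
rewrite expRD !mulrA ler_wpM2r ?expR_ge0//.
rewrite [leRHS]mulrC -mulrA ler_wpM2l ?exprn_ge0 ?divr_ge0 ?(ltW p0)//.
rewrite expRN ler_pdivrMr ?expR_gt0// -ler_pdivrMl ?ltr0n ?fact_gt0// mulrC.
(* The bound [1 + y^n / n! <= e^y] holds for positive [n] only, so [n = 0] uses [1 <= e^y]. *)
case: n => [|n]; first by rewrite expr0 fact0 invr1 mulr1 -expR0 ler_expR.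
by apply: le_trans (expR_ge1Dxn n y0); rewrite lerDr.
Qed.

Lemma cvgy_gauss p : 0 < p -> expR (- (p * x ^+ 2)) @[x --> +oo] --> (0 : R).
Proof.
move=> p0.
apply: (cvg_comp (fun x => p * x ^+ 2) (fun x => expR (- x))); last exact: cvgr_expR.
by apply: gt0_cvgMry => //; exact: cvgr_expr2.
Qed.

Lemma cvgy_XMgauss p n : 0 < p ->
  x ^+ n.*2 * expR (- p * x ^+ 2) @[x --> +oo] --> (0 : R).
Proof.
move=> p0; have p20 : 0 < p / 2 by rewrite divr_gt0.
apply: (@squeeze_cvgr _ _ _ _ (cst 0)
  (fun x => n`!%:R * (2 / p) ^+ n * expR (- (p / 2 * x ^+ 2)))).
- apply: nearW => x; rewrite XMgauss_le// andbT mulr_ge0 ?expR_ge0//.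
  by rewrite -mul2n exprM exprn_ge0// sqr_ge0.
- exact: cvg_cst.
- by rewrite -[X in _ --> X](mulr0 (n`!%:R * (2 / p) ^+ n)); apply: cvgM;
    [exact: cvg_cst|exact: cvgy_gauss].
Qed.

Lemma cvgy_gmoment_prim p n : 0 < p -> gmoment_prim p n x @[x --> +oo] --> (0 : R).
Proof.
move=> p0; have := cvgy_XMgauss _ p0.
elim: n => [|n IH] h /=.
  rewrite (_ : (fun x => _) =
      fun x : R => - (2 * p)^-1 * (x ^+ 0.*2 * expR (- p * x ^+ 2))).
    rewrite -[X in _ --> X](mulr0 (- (2 * p)^-1)).
    by apply: cvgM; [exact: cvg_cst|exact: h].
  by apply/funext => x; rewrite expr0; ring.
rewrite (_ : (fun x => _) = fun x : R =>
    - (2 * p)^-1 * (x ^+ n.+1.*2 * expR (- p * x ^+ 2)) +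
    n.+1%:R / p * gmoment_prim p n x).
  rewrite -[X in _ --> X]addr0 -[X in _ --> X + _](mulr0 (- (2 * p)^-1)).
  rewrite -[X in _ --> _ + X](mulr0 (n.+1%:R / p)).
  by apply: cvgD; apply: cvgM; [exact: cvg_cst|exact: h|exact: cvg_cst|exact: IH].
by apply/funext => x; ring.
Qed.

Lemma integral_gmoment p n : 0 < p ->
  (\int[mu]_(x in `[0%R, +oo[) (x ^+ n.*2.+1 * expR (- p * x ^+ 2))%:E =
   (n`!%:R / (2 * p ^+ n.+1))%:E)%E.
Proof.
move=> p0; have p_neq0 : p != 0 by rewrite gt_eqF.
rewrite (is_derive_FTC2y _ _ (fun x => is_derive_gmoment_prim n x p_neq0)
  (cvgy_gmoment_prim n p0)).
- by rewrite gmoment_prim0// sub0r opprK.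
- by move=> x x0; rewrite mulr_ge0 ?expR_ge0// exprn_ge0.
- exact: continuous_XMgauss.
Qed.

End moments.

(** * Power series, positivity and continuity of [I_0] *)

Section bessel.
Variable R : realType.
Local Notation mu := (@lebesgue_measure R).
Implicit Types (y z a x : R).

(** Moves real series to the extended reals, where sums of nonnegative terms commute with
    integrals. *)
Lemma eseries_EFin (u : R^nat) (l : R) : series u @ \oo --> l ->
  (\sum_(n <oo) (u n)%:E = l%:E)%E.
Proof.
move=> ul; rewrite -(cvg_lim _ ul)// -EFin_lim; last by apply/cvg_ex; exists l.
by apply/congr_lim/funext => n /=; rewrite /series/= sumEFin.
Qed.

Lemma expR_eseries y : (\sum_(n <oo) (y ^+ n / n`!%:R)%:E = (expR y)%:E)%E.
Proof. by apply: eseries_EFin; exact: is_cvg_series_exp_coeff. Qed.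

Definition cosh_coeff y n : R := y ^+ n.*2 / n.*2`!%:R.

Lemma cosh_coeff_ge0 y n : 0 <= cosh_coeff y n.
Proof. by rewrite /cosh_coeff divr_ge0// -mul2n exprM exprn_ge0// sqr_ge0. Qed.

(** The odd terms of the two exponential series cancel, so [n] terms here are the half-sum of [2n]
    terms of each. *)
Lemma cosh_eseries y :
  (\sum_(n <oo) (cosh_coeff y n)%:E = ((expR y + expR (- y)) / 2)%:E)%E.
Proof.
apply: eseries_EFin.
have cy := is_cvg_series_exp_coeff y; have cNy := is_cvg_series_exp_coeff (- y).
have h : (series (exp_coeff y) n.*2 + series (exp_coeff (- y)) n.*2) / 2
    @[n --> \oo] --> (expR y + expR (- y)) / 2.
  have d : n.*2 @[n --> \oo] --> \oo.
    rewrite (_ : double = muln 2); first exact: cvg_mulnl.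
    by apply/funext => n; rewrite mul2n.
  by apply: cvgM; [apply: cvgD; apply: (cvg_comp _ _ d)|exact: cvg_cst].
apply: cvg_trans h; apply: near_eq_cvg; apply: nearW => n.
rewrite /series/=; elim: n => [|n IH]; first by rewrite !big_geq// addr0 mul0r.
rewrite doubleS !big_nat_recr//= -IH /exp_coeff/= /cosh_coeff.
have -> : (- y) ^+ n.*2 = y ^+ n.*2 by rewrite exprNn -signr_odd odd_double mul1r.
have -> : (- y) ^+ n.*2.+1 = - y ^+ n.*2.+1.
  by rewrite exprNn -signr_odd /= odd_double mulN1r.
by field; rewrite !pnatr_eq0 -!lt0n !fact_gt0.
Qed.

Lemma continuous_expRcos z : continuous (fun t : R => expR (z * cos t)).
Proof.
move=> t; apply: (@continuous_comp _ _ _ (fun t => z * cos t) expR).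
  by apply: cvgM; [exact: cvg_cst|exact: continuous_cos].
exact: continuous_expR.
Qed.

(** The substitution [t -> pi - t] changes the sign of [cos t]. *)
Lemma Rintegral_expRcosN z :
  \int[mu]_(t in `[0, pi]) expR (z * cos t) =
  \int[mu]_(t in `[0, pi]) expR (- (z * cos t)).
Proof.
have D (t : R) : is_derive t 1 (fun t : R => pi - t) (-1).
  rewrite (_ : (fun t : R => pi - t) = cst pi - id)//.
  by apply: is_derive_eq; rewrite sub0r.
have D1 : derive1 (fun t : R => pi - t) = cst (-1).
  by apply/funext => t; rewrite derive1E; apply: derive_val.
rewrite /Rintegral; congr fine.
have := @integration_by_substitution_decreasing R (fun t => pi - t)
  (fun t => expR (z * cos t)) 0 pi (pi_ge0 R).
rewrite subrr subr0 => ->.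
- apply: eq_integral => t _; rewrite D1 !fctE/= opprK mulr1.
  by rewrite cosB cospi sinpi mul0r addr0 mulN1r mulrN.
- by move=> s t _ _ st; rewrite ltrD2l ltrN2.
- by rewrite D1 => t _; exact: cvg_cst.
- by rewrite D1; exact: is_cvg_cst.
- by rewrite D1; exact: is_cvg_cst.
- exact: is_derive_LRcontinuous D.
- exact/continuous_subspaceT/continuous_expRcos.
Qed.

(** Averaging over the sign of [z] leaves only even powers, hence nonnegative terms that can be
    integrated one by one. *)
Lemma besselI0_cosh z : besselI0 z =
  pi^-1 * \int[mu]_(t in `[0, pi]) ((expR (z * cos t) + expR (- (z * cos t))) / 2).
Proof.
rewrite /besselI0; congr (_ * _).
have i1 : mu.-integrable `[0, pi] (EFin \o (fun t : R => expR (z * cos t))).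
  exact/continuous_integrable_itv/continuous_expRcos.
have i2 : mu.-integrable `[0, pi] (EFin \o (fun t : R => expR (- (z * cos t)))).
  rewrite (_ : (fun _ => _) = (fun t : R => expR ((- z) * cos t))).
    exact/continuous_integrable_itv/continuous_expRcos.
  by apply/funext => t; rewrite mulNr.
rewrite RintegralZr//; last exact: (integrableD _ i1 i2).
rewrite RintegralD// -Rintegral_expRcosN.
by field.
Qed.

Lemma besselI0_eseries z :
  (\sum_(n <oo) (z ^+ n.*2 / (4 ^+ n * n`!%:R ^+ 2))%:E = (besselI0 z)%:E)%E.
Proof.
have pi0 := pi_gt0 R.
rewrite besselI0_cosh EFinM.
have cc : continuous (fun t : R => (expR (z * cos t) + expR (- (z * cos t))) / 2).
  move=> t; apply: cvgM; last exact: cvg_cst.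
  apply: cvgD; first exact: continuous_expRcos.
  have := @continuous_expRcos (- z) t.
  by rewrite /continuous_at; under eq_fun do rewrite mulNr; rewrite mulNr.
rewrite /Rintegral fineK; last first.
  by apply: integrable_fin_num => //; exact: continuous_integrable_itv.
transitivity ((pi^-1)%:E *
    \int[mu]_(t in `[0%R, pi])
      (\sum_(n <oo) (cosh_coeff (z * cos t) n)%:E))%E; last first.
  by congr (_ * _)%E; apply: eq_integral => t _; rewrite cosh_eseries.
have cW n : continuous (fun t : R => cosh_coeff (z * cos t) n).
  move=> t; apply: cvgM; last exact: cvg_cst.
  apply: (@continuous_comp _ _ _ (fun t => z * cos t) (fun z => z ^+ n.*2)).
    by apply: cvgM; [exact: cvg_cst|exact: continuous_cos].
  exact: exprn_continuous.
(* Monotone convergence exchanges sum and integral; the Wallis value then cancels the [(2n)!] of the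
   cosh coefficient. *)
rewrite integral_nneseries//; last 2 first.
- move=> n; apply/measurable_EFinP/measurable_funTS.
  exact: continuous_measurable_fun.
- by move=> n t _; rewrite lee_fin cosh_coeff_ge0.
rewrite -nneseriesZl; last first.
  by move=> n _; apply: integral_ge0 => t _; rewrite lee_fin cosh_coeff_ge0.
apply: eq_eseriesr => n _.
rewrite -[X in (_ * X)%E]fineK; last first.
  by apply: integrable_fin_num => //; exact: continuous_integrable_itv.
rewrite -EFinM; congr EFin.
rewrite -[fine _]/(Rintegral _ _ _) /cosh_coeff.
under eq_Rintegral do rewrite exprMn mulrAC.
rewrite RintegralZl//; last exact/continuous_integrable_itv/continuous_cosX.
rewrite Rintegral_cosX /wallis.
have f0 k : k`!%:R != 0 :> R by rewrite pnatr_eq0 -lt0n fact_gt0.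
have := f0 n.*2; have := f0 n; have := lt0r_neq0 pi0.
have : 4 ^+ n != 0 :> R by rewrite expf_neq0.
move: (4 ^+ n) (pi) (n`!%:R) (n.*2`!%:R) => a b c d a0 b0 c0 d0.
by field; rewrite a0 b0 c0 d0.
Qed.

Lemma besselI0_ge0 z : 0 <= besselI0 z.
Proof.
rewrite /besselI0 mulr_ge0 ?invr_ge0 ?pi_ge0//.
by apply: Rintegral_ge0 => t _; exact: expR_ge0.
Qed.

Lemma besselI00 : besselI0 (0 : R) = 1.
Proof.
rewrite /besselI0; under eq_Rintegral do rewrite mul0r expR0.
rewrite Rintegral_cst//= lebesgue_measure_itv/= lte_fin pi_gt0/= oppr0 addr0.
by rewrite mul1r mulVf// gt_eqF// pi_gt0.
Qed.

Lemma continuous_besselI0 : continuous (@besselI0 R).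
Proof.
move=> z; apply: cvgM; first exact: cvg_cst.
have zI : z \in `]z - 1, z + 1[%classic.
  by rewrite inE/= in_itv/=; lra.
(* On the window of radius 1 around [z] the integrand is dominated by the constant [e^(|z| + 1)],
   since [|cos t| <= 1]. *)
apply: (@continuity_under_integral R _ _ mu (fun z t => expR (z * cos t)) `[0, pi]
  _ (z - 1) (z + 1) _ _ (cst (expR (`|z| + 1)))) => //.
- by move=> x _; exact/continuous_integrable_itv/continuous_expRcos.
- apply: aeW => t _ x _.
  apply: (@continuous_comp _ _ _ (fun x => x * cos t) expR).
    by apply: cvgM; [exact: cvg_id|exact: cvg_cst].
  exact: continuous_expR.
- by apply: continuous_integrable_itv => ?; exact: cvg_cst.
- move=> x /=; rewrite in_itv/= => /andP[x1 x2]; apply: aeW => t _.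
  rewrite ger0_norm ?expR_ge0// ler_expR (le_trans (ler_norm _))// normrM.
  have xz : `|x| <= `|z| + 1.
    have := ler_normD (x - z) z; rewrite subrK => /le_trans; apply.
    by rewrite addrC lerD2l ler_norml; lra.
  rewrite -[leRHS]mulr1 ler_pM//.
  by rewrite ler_norml cos_geN1 cos_le1.
Qed.

End bessel.

(** * Rice density, Marcum Q-function and one-port integrals *)

Section rice.
Variable R : realType.
Local Notation mu := (@lebesgue_measure R).
Implicit Types (a b c x z : R).

(** Supplies the dominating bound for the continuity of [Q_1] in its first argument. *)
Lemma besselI0_le_expR z : besselI0 z <= expR `|z|.
Proof.
have pi0 := pi_gt0 R.
rewrite /besselI0 mulrC ler_pdivrMr//.
apply: (@le_trans _ _ (\int[mu]_(t in `[0, pi]) expR `|z|)).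
  apply: le_Rintegral => //.
  - exact/continuous_integrable_itv/continuous_expRcos.
  - by apply: continuous_integrable_itv => ?; exact: cvg_cst.
  - move=> t _; rewrite ler_expR (le_trans (ler_norm _))// normrM.
    by rewrite ler_piMr// ler_norml cos_geN1 cos_le1.
by rewrite Rintegral_cst//= lebesgue_measure_itv/= lte_fin pi0/= oppr0 addr0.
Qed.

(** Exactly the integrand of [marcumQ1], so that [Q_1] is its tail integral by definition. *)
Definition rice_pdf a x := x * expR (- (x ^+ 2 + a ^+ 2) / 2) * besselI0 (a * x).

Lemma rice_pdf_ge0 a x : 0 <= x -> 0 <= rice_pdf a x.
Proof.
by move=> x0; apply: mulr_ge0 (besselI0_ge0 _); rewrite mulr_ge0 ?expR_ge0.
Qed.

Lemma continuous_rice_pdf a : continuous (rice_pdf a).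
Proof.
move=> x; apply: cvgM.
  apply: cvgM; first exact: cvg_id.
  apply: (@continuous_comp _ _ _ (fun x => - (x ^+ 2 + a ^+ 2) / 2) expR);
    last exact: continuous_expR.
  apply: cvgM; last exact: cvg_cst.
  by apply: cvgN; apply: cvgD; [exact: exprn_continuous|exact: cvg_cst].
apply: (@continuous_comp _ _ _ (fun x => a * x) (@besselI0 R)).
  by apply: cvgM; [exact: cvg_cst|exact: cvg_id].
exact: continuous_besselI0.
Qed.

Lemma continuous_rice_pdfl x : continuous (rice_pdf ^~ x).
Proof.
move=> a; apply: cvgM.
  apply: cvgM; first exact: cvg_cst.
  apply: (@continuous_comp _ _ _ (fun a => - (x ^+ 2 + a ^+ 2) / 2) expR);
    last exact: continuous_expR.
  apply: cvgM; last exact: cvg_cst.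
  by apply: cvgN; apply: cvgD; [exact: cvg_cst|exact: exprn_continuous].
apply: (@continuous_comp _ _ _ (fun a => a * x) (@besselI0 R)).
  by apply: cvgM; [exact: cvg_id|exact: cvg_cst].
exact: continuous_besselI0.
Qed.

Lemma integral_rice_pdf a :
  (\int[mu]_(x in `[0%R, +oo[) (rice_pdf a x)%:E = 1)%E.
Proof.
(* The [n]-th term of the [I_0] series is split into a factor [w n] free of [x] and an odd Gaussian
   moment integrand [f n] with [p = 1/2]. *)
pose w n : R := expR (- (a ^+ 2 / 2)) * (a ^+ n.*2 / (4 ^+ n * n`!%:R ^+ 2)).
have w0 n : 0 <= w n.
  by rewrite mulr_ge0 ?expR_ge0// divr_ge0// -mul2n exprM exprn_ge0// sqr_ge0.
pose f n x : R := x ^+ n.*2.+1 * expR (- 2^-1 * x ^+ 2).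
have f0 n x : 0 <= x -> 0 <= f n x.
  by move=> x0; rewrite mulr_ge0 ?expR_ge0// exprn_ge0.
have mf n : measurable_fun (`[0%R, +oo[%classic : set R) (f n).
  apply: measurable_funTS; apply: continuous_measurable_fun.
  exact: continuous_XMgauss.
transitivity (\int[mu]_(x in `[0%R, +oo[) (\sum_(n <oo) (w n)%:E * (f n x)%:E))%E.
  apply: eq_integral => x; rewrite inE/= in_itv/= andbT => x0.
  rewrite /rice_pdf EFinM -besselI0_eseries -nneseriesZl; last first.
    move=> n _; rewrite lee_fin divr_ge0//.
    by rewrite -mul2n exprM exprn_ge0// sqr_ge0.
  apply: eq_eseriesr => n _; rewrite -!EFinM; congr EFin.
  rewrite /w /f.
  have -> : - (x ^+ 2 + a ^+ 2) / 2 = - (a ^+ 2 / 2) + - 2^-1 * x ^+ 2 by field.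
  by rewrite expRD exprMn [x ^+ n.*2.+1]exprS; ring.
rewrite integral_nneseries//; last 2 first.
- by move=> n; apply: measurable_funeM; apply/measurable_EFinP; exact: mf.
- move=> n x /=; rewrite in_itv/= andbT => x0.
  by rewrite mule_ge0// lee_fin ?w0 ?f0.
(* The moment equals [n! * 2^n], which cancels one [n!] and turns [4^n] into [2^n]; what remains is
   the series of [e^(a^2/2)]. *)
transitivity (\sum_(n <oo) (expR (- (a ^+ 2 / 2)))%:E *
    ((a ^+ 2 / 2) ^+ n / n`!%:R)%:E)%E.
  apply: eq_eseriesr => n _.
  rewrite ge0_integralZl_EFin//; last 2 first.
  - by move=> x /=; rewrite in_itv/= andbT => x0; rewrite lee_fin f0.
  - by apply/measurable_EFinP; exact: mf.
  rewrite integral_gmoment ?invr_gt0// -!EFinM; congr EFin.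
  rewrite /w -mul2n exprM -mulrA; congr (_ * _).
  rewrite expr_div_n [2^-1 ^+ _]exprVn (exprS 2 n).
  have -> : 4 ^+ n = 2 ^+ n * 2 ^+ n :> R by rewrite -exprMn; congr (_ ^+ _); ring.
  have : 2 ^+ n != 0 :> R by rewrite expf_neq0.
  have : n`!%:R != 0 :> R by rewrite pnatr_eq0 -lt0n fact_gt0.
  move: (2 ^+ n) (n`!%:R) => d e d0 e0.
  by field; rewrite d0 e0.
rewrite nneseriesZl; last first.
  by move=> n _; rewrite lee_fin divr_ge0// exprn_ge0// divr_ge0// sqr_ge0.
by rewrite expR_eseries -EFinM -expRD addNr expR0.
Qed.

Lemma Rintegral_rice_pdf a b : 0 <= b ->
  \int[mu]_(x in `[0, b]) rice_pdf a x = 1 - marcumQ1 a b.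
Proof.
move=> b0; have I1 := integral_rice_pdf a.
have mr (A : set R) : measurable_fun A (EFin \o rice_pdf a).
  apply/measurable_EFinP/measurable_funTS; apply: continuous_measurable_fun.
  exact: continuous_rice_pdf.
have ir : mu.-integrable `[0, +oo[ (EFin \o rice_pdf a).
  apply/integrableP; split; first exact: mr.
  apply: (@le_lt_trans _ _ 1%E); last exact: ltry.
  rewrite -I1 le_eqVlt; apply/orP; left; apply/eqP; apply: eq_integral => x.
  rewrite inE/= in_itv/= andbT => x0.
  by rewrite ger0_norm ?rice_pdf_ge0.
have := @Rintegral_itvB R (rice_pdf a) (BLeft 0) +oo%O b ir.
rewrite bnd_simp => /(_ b0 isT).
(* Removing [[0, b]] leaves the half-line open at [b]; the null point [b] is added to match
   [marcumQ1]. *)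
rewrite Rintegral_itv_obnd_cbnd; last first.
  apply: integrableS ir => // x /=; rewrite !in_itv/= !andbT => /ltW.
  exact: le_trans.
have -> : \int[mu]_(x in `[0, +oo[) rice_pdf a x = 1 by rewrite /Rintegral I1.
rewrite -/(marcumQ1 a b) => <-.
by rewrite opprB addrC subrK.
Qed.

(** Makes the integrand in [x_1] of the final formula continuous, hence integrable. Passing to the
    complement [1 - Q_1] gives a bounded interval, where a constant can dominate. *)
Lemma continuous_marcumQ1l b : 0 <= b -> continuous (fun a => marcumQ1 a b).
Proof.
move=> b0.
suff cI : continuous (fun a => \int[mu]_(x in `[0, b]) rice_pdf a x).
  have -> : (fun a => marcumQ1 a b) = fun a => 1 - \int[mu]_(x in `[0, b]) rice_pdf a x.
    by apply/funext => a; rewrite Rintegral_rice_pdf// opprB addrC subrK.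
  by move=> a; apply: cvgB; [exact: cvg_cst|exact: cI].
move=> z.
have zI : z \in `]z - 1, z + 1[%classic by rewrite inE/= in_itv/=; lra.
(* The constant combines [x <= b], a Gaussian factor at most 1 and [I_0(a x) <= e^|a x|] with
   [|a| <= |z| + 1]. *)
apply: (@continuity_under_integral R _ _ mu rice_pdf `[0, b]
  _ (z - 1) (z + 1) _ _ (cst (b * expR ((`|z| + 1) * b)))) => //.
- by move=> x _; exact/continuous_integrable_itv/continuous_rice_pdf.
- by apply: aeW => x _ a _; exact: continuous_rice_pdfl.
- by apply: continuous_integrable_itv => ?; exact: cvg_cst.
- move=> a /=; rewrite in_itv/= => /andP[a1 a2]; apply: aeW => x /=.
  rewrite in_itv/= => /andP[x0 xb].
  rewrite ger0_norm ?rice_pdf_ge0//; apply: ler_pM.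
  - by rewrite mulr_ge0 ?expR_ge0.
  - exact: besselI0_ge0.
  - rewrite -[leRHS]mulr1; apply: ler_pM; rewrite ?expR_ge0//.
    by rewrite -expR0 ler_expR mulNr oppr_le0 divr_ge0// addr_ge0// sqr_ge0.
  apply: (le_trans (besselI0_le_expR _)); rewrite ler_expR normrM ler_pM//.
    have := ler_normD (a - z) z; rewrite subrK => /le_trans; apply.
    by rewrite addrC lerD2l ler_norml; lra.
  by rewrite ger0_norm.
Qed.

Lemma Rintegral_scale (G : R -> R) s b : continuous G -> 0 < s -> 0 <= b ->
  \int[mu]_(x in `[0, s * b]) G x = \int[mu]_(t in `[0, b]) (G (s * t) * s).
Proof.
move=> cG s0 b0.
have D (t : R) : is_derive t 1 (fun t : R => s * t) s.
  rewrite (_ : (fun t : R => s * t) = s \*: id)//.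
  by apply: is_derive_eq; rewrite /GRing.scale/= mulr1.
have D1 : derive1 (fun t : R => s * t) = cst s.
  by apply/funext => t; rewrite derive1E; apply: derive_val.
rewrite /Rintegral; congr fine.
have := @integration_by_substitution_increasing R (fun t => s * t) G 0 b b0.
rewrite mulr0 => ->.
- by apply: eq_integral => t _; rewrite D1.
- by move=> x y _ _ xy; rewrite ltr_pM2l.
- by rewrite D1 => t _; exact: cvg_cst.
- by rewrite D1; exact: is_cvg_cst.
- by rewrite D1; exact: is_cvg_cst.
- exact: is_derive_LRcontinuous D.
- exact: continuous_subspaceT.
Qed.

(** One factor of [fas_joint_pdf]; for a port other than the first, the density of its envelope at
    [x] given the value [x1] at port 1. *)
Definition port_pdf (m c x1 x : R) : R :=
  (2 * x / c) * expR (- (x ^+ 2 + m ^+ 2 * x1 ^+ 2) / c)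
    * besselI0 (2 * m * x1 * x / c).

(** The trailing [sqrt (2/c)] is the Jacobian of the scaling [x -> sqrt (2/c) x]; the sign of [m]
    lets it leave the square root. *)
Lemma port_pdf_rice m c x1 x : 0 <= m -> 0 < c ->
  port_pdf m c x1 x =
  rice_pdf (Num.sqrt (2 * m ^+ 2 / c) * x1) (Num.sqrt (2 / c) * x) * Num.sqrt (2 / c).
Proof.
move=> m0 c0; have c1 : 0 <= 2 / c by rewrite divr_ge0// ltW.
have -> : Num.sqrt (2 * m ^+ 2 / c) = m * Num.sqrt (2 / c).
  by rewrite mulrAC mulrC sqrtrM ?sqr_ge0// sqrtr_sqr ger0_norm.
have := sqr_sqrtr c1; move: (Num.sqrt _) => s sE.
rewrite /port_pdf /rice_pdf.
have -> : - ((s * x) ^+ 2 + (m * s * x1) ^+ 2) / 2 = - (x ^+ 2 + m ^+ 2 * x1 ^+ 2) / c.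
  by rewrite !exprMn sE; field; rewrite gt_eqF.
have -> : m * s * x1 * (s * x) = 2 * m * x1 * x / c.
  have -> : m * s * x1 * (s * x) = s ^+ 2 * m * x1 * x by ring.
  by rewrite sE; ring.
have -> : 2 * x / c = s ^+ 2 * x by rewrite sE; ring.
by ring.
Qed.

Lemma continuous_port_pdf m c x1 : continuous (port_pdf m c x1).
Proof.
move=> x; apply: cvgM.
  apply: cvgM.
    by apply: cvgM; [apply: cvgM; [exact: cvg_cst|exact: cvg_id]|exact: cvg_cst].
  apply: (@continuous_comp _ _ _ (fun x => - (x ^+ 2 + m ^+ 2 * x1 ^+ 2) / c) expR);
    last exact: continuous_expR.
  apply: cvgM; last exact: cvg_cst.
  by apply: cvgN; apply: cvgD; [exact: exprn_continuous|exact: cvg_cst].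
apply: (@continuous_comp _ _ _ (fun x => 2 * m * x1 * x / c) (@besselI0 R)).
  by apply: cvgM; [apply: cvgM; [exact: cvg_cst|exact: cvg_id]|exact: cvg_cst].
exact: continuous_besselI0.
Qed.

Lemma Rintegral_port_pdf m c x1 b : 0 <= m -> 0 < c -> 0 <= b ->
  \int[mu]_(x in `[0, b]) port_pdf m c x1 x =
  1 - marcumQ1 (Num.sqrt (2 * m ^+ 2 / c) * x1) (Num.sqrt (2 / c) * b).
Proof.
move=> m0 c0 b0; have s0 : 0 < Num.sqrt (2 / c) by rewrite sqrtr_gt0 divr_gt0.
have := Rintegral_rice_pdf (Num.sqrt (2 * m ^+ 2 / c) * x1) (mulr_ge0 (ltW s0) b0).
rewrite (Rintegral_scale (@continuous_rice_pdf _) s0 b0) => <-.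
by apply: eq_Rintegral => x _; exact: port_pdf_rice.
Qed.

Lemma Rintegral_gauss_moment1 p : 0 < p ->
  \int[mu]_(x in `[0, +oo[) (x * expR (- p * x ^+ 2)) = (2 * p)^-1.
Proof.
move=> p0; have /(congr1 fine) := integral_gmoment 0 p0.
by rewrite /= fact0 div1r expr1.
Qed.

Lemma integrable_gauss_moment1 p : 0 < p ->
  mu.-integrable `[0, +oo[ (EFin \o (fun x : R => x * expR (- p * x ^+ 2))).
Proof.
move=> p0; have I := integral_gmoment 0 p0.
apply/integrableP; split.
  apply/measurable_EFinP/measurable_funTS; apply: continuous_measurable_fun.
  exact: (@continuous_XMgauss R p 1).
apply: le_lt_trans (ltry (0`!%:R / (2 * p ^+ 1))).
rewrite -I le_eqVlt; apply/orP; left; apply/eqP.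
apply: eq_integral => x; rewrite inE/= in_itv/= andbT => x0.
by rewrite expr1 ger0_norm// mulr_ge0 ?expR_ge0.
Qed.

End rice.

(** * Factorization of the iterated integrals over the ports *)

Section fas.
Variable R : realType.
Local Notation mu := (@lebesgue_measure R).

(** Induction on [s]: the variable [x_j] occurs only in factor [j], so the others leave the integral
    as constants. Since [x_1] enters every factor, port 1 is kept out of [s]. *)
Lemma iter_int_prod (g : nat -> R -> R -> R) (r s : seq nat) (b : R) (x : nat -> R) :
  (forall k u, continuous (g k u)) ->
  uniq r -> uniq s -> 1%N \notin s -> {subset s <= r} ->
  iter_int s b (fun x => \prod_(k <- r) g k (x 1%N) (x k)) x =
  \prod_(k <- r) (if k \in s then \int[mu]_(t in `[0, b]) g k (x 1%N) t
                  else g k (x 1%N) (x k)).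
Proof.
move=> cg ur; elim: s x => [|j s IH] x us s1 sr //.
move: us s1 => /= /andP[js us]; rewrite inE negb_or => /andP[j1 s1].
have jr : j \in r by apply: sr; rewrite inE eqxx.
under eq_Rintegral => t _.
  rewrite IH//; last by move=> k ks; apply: sr; rewrite inE ks orbT.
  rewrite /upd (negbTE j1) (bigD1_seq j)//= (negbTE js) eqxx.
  under eq_bigr => k kj do rewrite (negbTE kj).
  over.
rewrite RintegralZr//; last exact: continuous_integrable_itv.
rewrite [RHS](bigD1_seq j)//= inE eqxx/=; congr (_ * _).
by apply: eq_bigr => k kj; rewrite inE (negbTE kj).
Qed.

(** A centred Gaussian of variance [v] has half-line first moment [sqrt (v / (2 pi))], and here
    [sqrt v = pi * sigma * fD]. [A] stands for the part depending on the threshold. *)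
Lemma Rintegral_deriv_pdf (sigma fD A : R) : 0 < sigma -> 0 < fD ->
  \int[mu]_(xd in `[0, +oo[) (xd * (deriv_pdf sigma fD xd * A)) =
  pi * sigma * fD / Num.sqrt (2 * pi) * A.
Proof.
move=> s0 f0; have pi0 := pi_gt0 R.
pose v : R := pi ^+ 2 * sigma ^+ 2 * fD ^+ 2.
have v0 : 0 < v by rewrite !mulr_gt0// exprn_gt0.
have p0 : 0 < (2 * v)^-1 by rewrite invr_gt0 mulr_gt0.
have sE : Num.sqrt (2 * pi * v) = Num.sqrt (2 * pi) * (pi * sigma * fD).
  rewrite sqrtrM ?mulr_ge0 ?(ltW pi0)//; congr (_ * _).
  by rewrite /v -!exprMn sqrtr_sqr gtr0_norm ?mulr_gt0.
have q0 : Num.sqrt (2 * pi) != 0 :> R by rewrite gt_eqF// sqrtr_gt0 mulr_gt0.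
transitivity (\int[mu]_(x in `[0, +oo[)
    (A / Num.sqrt (2 * pi * v) * (x * expR (- (2 * v)^-1 * x ^+ 2)))).
  apply: eq_Rintegral => x _; rewrite /deriv_pdf -/v.
  have -> : - x ^+ 2 / (2 * v) = - (2 * v)^-1 * x ^+ 2 by ring.
  by ring.
rewrite RintegralZl//; last exact: integrable_gauss_moment1.
rewrite Rintegral_gauss_moment1// sE /v.
move: pi0 q0; move: (Num.sqrt _) => q; move: (pi) => w w0 q0.
by field; rewrite q0 !gt_eqF.
Qed.

Variables (N : nat) (sigma : R) (m : nat -> R).
Hypothesis sigma0 : 0 < sigma.
Hypothesis m01 : forall k, (2 <= k <= N)%N -> 0 <= m k < 1.

Local Notation c k := (sigma ^+ 2 * (1 - m k ^+ 2)).

Local Notation g k :=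
  (port_pdf (muc m k) (sigma ^+ 2 * (1 - muc m k ^+ 2))).

Local Notation Q k x1 x :=
  (1 - marcumQ1 (Num.sqrt (2 * m k ^+ 2 / c k) * x1) (Num.sqrt (2 / c k) * x)).

Lemma port_scale_gt0 k : (2 <= k <= N)%N -> 0 < c k.
Proof.
move=> /m01/andP[m0 m1]; rewrite mulr_gt0 ?exprn_gt0// subr_gt0.
by rewrite expr_lt1.
Qed.

Lemma Rintegral_port k x1 b : (2 <= k <= N)%N -> 0 <= b ->
  \int[mu]_(t in `[0, b]) g k x1 t = Q k x1 b.
Proof.
move=> kN b0; have := port_scale_gt0 kN; have /andP[m0 _] := m01 kN.
rewrite /muc; case: k kN m0 => [|[|k]]//= kN m0 c0.
exact: Rintegral_port_pdf.
Qed.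

(** The convention [mu_1 = 0] and [I_0(0) = 1] reduce the factor to the Rayleigh density. *)
Lemma port1_pdf x1 x : g 1 x1 x = 2 * x / sigma ^+ 2 * expR (- x ^+ 2 / sigma ^+ 2).
Proof.
rewrite /port_pdf /muc/= expr0n/= subr0 mulr1 mul0r addr0 mulr0 !mul0r.
by rewrite besselI00 mulr1.
Qed.

(** The list [s] is left general to serve twice: all ports but the first, and all ports but the
    first and [i] once [x_1] is fixed. *)
Lemma iter_int_fas s b x : uniq s -> {subset s <= index_iota 2 N.+1} -> 0 <= b ->
  iter_int s b (fas_joint_pdf N sigma m) x =
  \prod_(1 <= k < N.+1) (if k \in s then Q k (x 1%N) b else g k (x 1%N) (x k)).
Proof.
move=> us sN b0.
have := @iter_int_prod (fun k => g k) (index_iota 1 N.+1) s b x.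
rewrite iota_uniq => ->//.
- apply: eq_bigr => k _; case: ifPn => // /sN; rewrite mem_index_iota => kN.
  exact: Rintegral_port.
- by move=> k u; exact: continuous_port_pdf.
- by apply/negP => /sN; rewrite mem_index_iota.
- by move=> k /sN; rewrite !mem_index_iota; lia.
Qed.

Hypothesis N2 : (2 <= N)%N.

Lemma iter_int_port1 b : 0 <= b ->
  iter_int [seq k <- iota 1 N | k != 1%N] b (fas_joint_pdf N sigma m) (fun _ => b) =
  2 * b / sigma ^+ 2 * (expR (- b ^+ 2 / sigma ^+ 2) * \prod_(2 <= k < N.+1) Q k b b).
Proof.
move=> b0; rewrite iter_int_fas//; last 2 first.
- by rewrite filter_uniq// iota_uniq.
- by move=> k; rewrite mem_filter mem_index_iota mem_iota; lia.
rewrite big_ltn; last by lia.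
rewrite mem_filter/= port1_pdf mulrA; congr (_ * _).
apply: eq_big_nat => k kN; rewrite mem_filter mem_iota ifT//.
by lia.
Qed.

Lemma iter_int_port i b : (2 <= i <= N)%N -> 0 <= b ->
  iter_int [seq k <- iota 1 N | k != i] b (fas_joint_pdf N sigma m) (fun _ => b) =
  2 * b / sigma ^+ 2 * ((1 - m i ^+ 2)^-1 * expR (- b ^+ 2 / c i) *
    \int[mu]_(x1 in `[0, b])
      (2 * x1 / sigma ^+ 2 * expR (- x1 ^+ 2 / c i) * besselI0 (2 * m i * b * x1 / c i)
       * \prod_(2 <= k < N.+1 | k != i) Q k x1 b)).
Proof.
move=> iN b0; have ci0 := port_scale_gt0 iN; have /andP[mi0 mi1] := m01 iN.
(* Port 1 heads the list, so its integral is outermost and the inner ones factor at fixed [x_1]. *)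
have -> : [seq k <- iota 1 N | k != i] = 1%N :: [seq k <- iota 2 N.-1 | k != i].
  case: (N) N2 iN => // N' _ iN /=.
  by case: eqP => // i1; move: iN; rewrite -i1.
have cE : continuous (fun x1 : R => expR (- x1 ^+ 2 / c i)).
  move=> t; apply: (@continuous_comp _ _ _ (fun x1 : R => - x1 ^+ 2 / c i) expR).
    by apply: cvgM; [apply: cvgN; exact: exprn_continuous|exact: cvg_cst].
  exact: continuous_expR.
have cI : continuous (fun x1 : R => besselI0 (2 * m i * b * x1 / c i)).
  move=> t; apply: (@continuous_comp _ _ _
    (fun x1 : R => 2 * m i * b * x1 / c i) (@besselI0 R)).
    by apply: cvgM; [apply: cvgM; [exact: cvg_cst|exact: cvg_id]|exact: cvg_cst].
  exact: continuous_besselI0.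
have cQ k : continuous (fun x1 : R => Q k x1 b).
  move=> t; apply: cvgB; first exact: cvg_cst.
  apply: (@continuous_comp _ _ _ (fun x1 : R => Num.sqrt (2 * m k ^+ 2 / c k) * x1)
    (fun a => marcumQ1 a (Num.sqrt (2 / c k) * b))).
    by apply: cvgM; [exact: cvg_cst|exact: cvg_id].
  by apply: continuous_marcumQ1l; rewrite mulr_ge0// sqrtr_ge0.
have cP : continuous (fun x1 : R => \prod_(2 <= k < N.+1 | k != i) Q k x1 b).
  apply: continuous_big => [|k _]; last exact: cQ.
  exact: mul_continuous.
have cF : continuous (fun x1 : R => 2 * x1 / sigma ^+ 2 * expR (- x1 ^+ 2 / c i)
    * besselI0 (2 * m i * b * x1 / c i) * \prod_(2 <= k < N.+1 | k != i) Q k x1 b).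
  move=> t; apply: cvgM (cP t); apply: cvgM (cI t); apply: cvgM (cE t).
  by apply: cvgM; [apply: cvgM; [exact: cvg_cst|exact: cvg_id]|exact: cvg_cst].
(* The constants go under the integral in [x_1], so that both sides can be compared pointwise. *)
rewrite [LHS]/= mulrA -RintegralZl//; last exact: continuous_integrable_itv.
apply: eq_Rintegral => t _; rewrite iter_int_fas//; last 2 first.
- by rewrite filter_uniq// iota_uniq.
- by move=> k; rewrite mem_filter mem_index_iota mem_iota; lia.
rewrite big_ltn; last by lia.
rewrite mem_filter mem_iota/= andbF /upd/= port1_pdf.
(* Port [i] is not integrated: its factor is evaluated at [x_i = b] and split off. *)
rewrite (bigD1_seq i) ?iota_uniq ?mem_index_iota//= mem_filter eqxx/=.
have i1 : (i == 1%N) = false by apply/negbTE; lia.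
rewrite i1 [LHS]mulrA [RHS]mulrA; congr (_ * _); last first.
  rewrite big_seq_cond [RHS]big_seq_cond; apply: eq_bigr => k /andP[].
  rewrite mem_index_iota => kN ki; rewrite mem_filter ki mem_iota ifT//.
  by lia.
rewrite /port_pdf /muc i1.
have -> : 2 * m i * t * b / c i = 2 * m i * b * t / c i by ring.
(* The exponents of ports 1 and [i] merge because [1 + mu^2 / (1 - mu^2) = 1 / (1 - mu^2)]. *)
have E : expR (- t ^+ 2 / sigma ^+ 2) * expR (- (b ^+ 2 + m i ^+ 2 * t ^+ 2) / c i) =
    expR (- b ^+ 2 / c i) * expR (- t ^+ 2 / c i).
  rewrite -!expRD; congr expR; field.
  by rewrite !gt_eqF// subr_gt0 expr_lt1.
transitivity (2 * t / sigma ^+ 2 * (2 * b / c i) *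
   (expR (- t ^+ 2 / sigma ^+ 2) * expR (- (b ^+ 2 + m i ^+ 2 * t ^+ 2) / c i)) *
   besselI0 (2 * m i * b * t / c i)); first by ring.
rewrite E.
have -> : 2 * b / c i = 2 * b / sigma ^+ 2 * (1 - m i ^+ 2)^-1.
  by rewrite invfM; ring.
by ring.
Qed.

End fas.

Theorem theorem1 (R : realType) (N : nat) (sigma fD : R) (m : nat -> R) (xth : R) :
  (2 <= N)%N -> 0 < sigma -> 0 < fD ->
  (forall k, (2 <= k <= N)%N -> 0 <= m k < 1) ->
  0 < xth ->
  fas_lcr N sigma fD m xth =
    Num.sqrt (2 * pi) * xth * fD / sigma *
    ( expR (- xth ^+ 2 / sigma ^+ 2) *
        \prod_(2 <= k < N.+1)
          (1 - marcumQ1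
                 (Num.sqrt (2 * m k ^+ 2 / (sigma ^+ 2 * (1 - m k ^+ 2))) * xth)
                 (Num.sqrt (2 / (sigma ^+ 2 * (1 - m k ^+ 2))) * xth))
      + \sum_(2 <= i < N.+1)
          ((1 - m i ^+ 2)^-1 * expR (- xth ^+ 2 / (sigma ^+ 2 * (1 - m i ^+ 2))) *
           Rintegral (@lebesgue_measure R) `[0, xth]
             (fun x1 =>
                2 * x1 / sigma ^+ 2 * expR (- x1 ^+ 2 / (sigma ^+ 2 * (1 - m i ^+ 2)))
                * besselI0 (2 * m i * xth * x1 / (sigma ^+ 2 * (1 - m i ^+ 2)))
                * \prod_(2 <= k < N.+1 | k != i)
                    (1 - marcumQ1
                           (Num.sqrt (2 * m k ^+ 2 / (sigma ^+ 2 * (1 - m k ^+ 2))) * x1)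
                           (Num.sqrt (2 / (sigma ^+ 2 * (1 - m k ^+ 2))) * xth))))).
Proof.
move=> N2 s0 f0 m01 x0; have pi0 := pi_gt0 R.
rewrite /fas_lcr /fas_joint_deriv_pdf.
(* The derivative density is the same at every port and leaves the sum over ports. *)
under eq_Rintegral do rewrite -mulr_sumr.
rewrite Rintegral_deriv_pdf//.
have N1 : (1 < N.+1)%N by rewrite ltnS ltnW.
rewrite (big_ltn N1).
rewrite (iter_int_port1 s0 m01 N2 (ltW x0)).
set P := (X in _ = _ * (_ + X)).
have -> : \sum_(2 <= i < N.+1) iter_int [seq k <- iota 1 N | k != i] xth
    (fas_joint_pdf N sigma m) (fun=> xth) = 2 * xth / sigma ^+ 2 * P.
  rewrite /P mulr_sumr; apply: eq_big_nat => i iN.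
  exact: (iter_int_port s0 m01 N2 iN (ltW x0)).
rewrite -mulrDr mulrA; congr (_ * _).
have q2 : Num.sqrt (2 * pi) ^+ 2 = 2 * pi :> R by rewrite sqr_sqrtr// mulr_ge0// ltW.
have q0 : 0 < Num.sqrt (2 * pi) :> R by rewrite sqrtr_gt0 mulr_gt0.
move: (Num.sqrt _) q2 q0 => q q2 q0.
(* It remains that [pi sigma fD / q * 2 xth / sigma^2 = q xth fD / sigma] for [q = sqrt (2 pi)];
   after multiplying by [q], only [q^2 = 2 pi] matters. *)
apply: (mulfI (lt0r_neq0 q0)).
have -> : q * (q * xth * fD / sigma) = q ^+ 2 * xth * fD / sigma by ring.
rewrite q2; move: (pi) pi0 => w w0.
by field; rewrite !gt_eqF.
Qed.
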